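(* Let $G$ be a locally compact topological group, let $\mu_G$ be a Haar measure on $G$, and let $\rho$ and $\xi$ be information measures on $(G,\mu_G)$. Then for all compact $A\subset G$ (for which the entropies below are defined), $$S_\xi(\rho,A)\;\le\; S_{\mu_G}(\rho,A)\;\le\; S_{\mu_G}(\mu_G,A),$$ where, for every $g\in G$, $S_{\mu_G}(\mu_G,A)=S_{\mu_G}(\mu_G,gA)=\log\mu_G(A)$.
   Context: Groups are locally compact topological groups; a Haar measure is a left-invariant one, so $\mu_G(gA)=\mu_G(A)$. Absolute continuity $\eta\ll\nu$ is understood to provide a Radon–Nikodym density $\frac{d\eta}{d\nu}$ (defined up to $\nu$-null sets). Information measure: a measure $\rho$ on a measure space $(\mathcal X,\nu)$ (where $\nu$ is called the reference measure) is an information measure if $\rho\ll\nu$ and $\frac{d\rho}{d\nu}\in[0,1]$ ($\nu$-a.e.). It need not have unit mass. Relative entropy: for a measure $\eta$ with $\eta\ll\nu$ and a measurable set $A$ with $0<\eta(A)<\infty$, $$S_\nu(\eta,A)=\log\eta(A)-\frac1{\eta(A)}\int_A\frac{d\eta}{d\nu}\,\log\!\left(\frac{d\eta}{d\nu}\right)d\nu ,$$ with the convention $0\log 0=0$; the value $-\infty$ is allowed. Thus $S_\xi(\rho,A)$ presupposes $\rho\ll\xi$ on $A$, and $S_{\mu_G}(\rho,A)$ and $S_\xi(\rho,A)$ presuppose $\rho(A)>0$. *)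

(* Defs.v *)
From HB Require Import structures.
From mathcomp Require Import all_boot all_order all_algebra.
From mathcomp Require Import all_classical all_reals all_analysis.
From mathcomp Require Import measurable_realfun.

Set Implicit Arguments.
Unset Strict Implicit.
Unset Printing Implicit Defensive.

Import Order.TTheory GRing.Theory Num.Theory.

Local Open Scope classical_set_scope.
Local Open Scope ring_scope.
Local Open Scope ereal_scope.

(* The distinguished point, unrelated to the group law, is there only because
   measurable types are pointed in the library. No separation axiom. *)
HB.mixin Record isTopologicalGroup G of PointedTopological G & Group G := {
  mulg_continuous : continuous (fun x : G * G => (x.1 * x.2)%g) ;
  invg_continuous : continuous (fun x : G => (x^-1)%g)
}.

#[short(type="topologicalGroupType")]
HB.structure Definition TopologicalGroup :=
  {G of PointedTopological G & Group G & isTopologicalGroup G}.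

Notation borel T := (g_sigma_algebraType (@open T)).

Definition ltranslate (G : topologicalGroupType) (g : G) (A : set G) : set G :=
  [set (g * x)%g | x in A].

(* Nonzero left-invariant Radon measure. Compact sets are closed, hence Borel,
   in Hausdorff groups; measurability is asked for in the general case. *)
Record haar_measure (R : realType) (G : topologicalGroupType)
    (mu : {measure set (borel G) -> \bar R}) : Prop := HaarMeasure {
  haar_neq0 : mu [set: G] <> 0 ;
  haar_left_invariant : forall (g : G) (B : set (borel G)), measurable B ->
    mu (ltranslate g B) = mu B ;
  haar_compact_finite : forall K : set G, compact K ->
    measurable (K : set (borel G)) -> mu K < +oo ;
  haar_outer_regular : forall B : set (borel G), measurable B ->
    mu B = ereal_inf [set mu U | U in [set U : set G | open U /\ B `<=` U]] ;
  haar_inner_regular : forall U : set G, open U ->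
    mu U = ereal_sup [set mu K | K in [set K : set G |
      [/\ compact K, measurable (K : set (borel G)) & K `<=` U]]]
}.

Section information_measures_and_entropy.
Context d (T : measurableType d) (R : realType).
Implicit Types (nu eta rho : {measure set T -> \bar R}) (A D : set T).

Definition is_density nu eta D (f : T -> \bar R) : Prop :=
  [/\ measurable_fun D f,
      forall x, D x -> 0 <= f x &
      forall B, measurable B -> B `<=` D -> eta B = \int[nu]_(x in B) f x].

(* Absolute continuity on D in the strong sense that a density exists: this
   differs from the library's [eta `<< nu] when sigma-finiteness fails, as it
   may for the Haar measure of a group that is not sigma-compact. *)
Definition has_density nu eta D : Prop := exists f, is_density nu eta D f.

(* When eta D is finite, any two densities of eta on D agree nu-a.e. on D, so
   that [entropy] below does not depend on the one selected here. The library's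
   ['d eta '/d nu] is available only for finite eta and sigma-finite nu. *)
Definition density nu eta D : T -> \bar R :=
  xget (cst 0) [set f | is_density nu eta D f].

Definition information_measure nu rho : Prop :=
  exists2 f, is_density nu rho setT f & {ae nu, forall x, 0 <= f x <= 1}.

Definition entropy_defined nu eta A : Prop :=
  [/\ measurable A, has_density nu eta A & 0 < eta A < +oo].

(* Since lne 0 = -oo and 0 * -oo = 0, the convention 0 log 0 = 0 holds. *)
Definition entropy nu eta A : \bar R :=
  lne (eta A) -
  (eta A)^-1 * \int[nu]_(x in A) (density nu eta A x * lne (density nu eta A x)).

End information_measures_and_entropy.

(* Main.v *)
(* Let r and x be the densities of rho and xi with respect to mu, and t that of
   rho with respect to xi, so that r = t x almost everywhere on A. Since
   0 <= x <= 1, we have r ln r = (t ln t) x + r ln x <= (t ln t) x; integrating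
   against mu gives the first inequality. The second one is Jensen's inequality
   for r ln r, obtained by integrating the tangent line at
   c = rho A / mu A. *)
Require Import Defs.
From mathcomp Require Import all_boot all_order all_algebra.
From mathcomp Require Import all_classical all_reals all_analysis.
From mathcomp Require Import measurable_realfun.
From mathcomp Require Import ring lra.

Set Implicit Arguments.
Unset Strict Implicit.
Unset Printing Implicit Defensive.

Import Order.TTheory GRing.Theory Num.Theory.
Import HBNNSimple.

Local Open Scope classical_set_scope.
Local Open Scope ring_scope.
Local Open Scope ereal_scope.

(** * The function t log t on the extended reals *)

Section xlogx.
Context {R : realType}.
Implicit Types (t x : \bar R) (a c r : R).

(** Open upper rays generate the Borel sets, and by monotonicity the preimage of the ray from [a] is
    the ray from [expR a]. *)
Lemma measurable_lne : measurable_fun setT (@lne R).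
Proof.
apply: (measurability _ (ErealGenOInfty.measurableE R)).
move=> /= _ [_ [a ->]] <-; rewrite setTI.
have -> : @lne R @^-1` [set` `]a%:E, +oo[%R] = [set` `](expR a)%:E, +oo[%R].
  apply/seteqP; split=> -[r| |] /=; rewrite ?in_itv /= ?andbT ?ltry //.
  - by case: (leP r 0%R) => // r0; rewrite !lte_fin -ltr_expR lnK.
  - rewrite lte_fin => ar; have r0 := lt_trans (expR_gt0 a) ar.
    by rewrite leNgt r0 /= lte_fin -ltr_expR lnK ?posrE.
exact: emeasurable_itv.
Qed.

Definition xlogx t := t * lne t.

Lemma measurable_xlogx d (T : measurableType d) (D : set T) (f : T -> \bar R) :
  measurable_fun D f -> measurable_fun D (xlogx \o f).
Proof.
move=> mf; apply: emeasurable_funM => //.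
by apply: (measurable_comp measurableT) => //; exact: measurable_lne.
Qed.

(** For finite positive [t] and [x] the left side exceeds the right by [t * x * ln x], which is
    nonpositive. If [t = +oo] and [x > 0], both sides are [+oo]. *)
Lemma xlogx_mul_le t x : 0 <= t -> 0 <= x <= 1 ->
  xlogx (t * x) <= xlogx t * x.
Proof.
rewrite /xlogx => t0 /andP[]; case: x => [x| |] //.
rewrite !lee_fin le_eqVlt => /predU1P[<- _|x0 x1].
  by rewrite !mule0 mul0e.
case: t t0 => [t| |] // t0; last first.
  by rewrite gt0_mulye ?lte_fin //= mulyy gt0_mulye ?lte_fin.
move: t0; rewrite lee_fin le_eqVlt => /predU1P[<-|t0]; first by rewrite !mul0e.
rewrite -EFinM !lne_EFin ?mulr_gt0 // -!EFinM lee_fin lnM ?posrE //.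
rewrite (mulrAC t (ln t) x).
rewrite ler_pM2l ?mulr_gt0 //.
by have := ln_le0 x1; lra.
Qed.

(* The tangent line of [r ln r] at [c]. *)
Lemma xlogx_ge_tangent c r : (0 < c)%R -> (0 <= r)%R ->
  (r * (ln c + 1) - c)%:E <= xlogx r%:E.
Proof.
rewrite /xlogx => c0; rewrite le_eqVlt => /predU1P[<-|r0].
  by rewrite mul0e mul0r lee_fin; lra.
rewrite lne_EFin // -EFinM lee_fin.
have cr : (0 < c / r)%R by rewrite divr_gt0.
(* The inequality ln (1 + u) <= u at u = c / r - 1, multiplied by [r] below. *)
have := @le_ln1Dx R (c / r - 1); rewrite (addrC 1%R) subrK ln_div ?posrE //.
move=> h; have {}h : (ln c - ln r <= c / r - 1)%R by apply: h; lra.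
have : (r * (ln c - ln r) <= r * (c / r - 1))%R by rewrite ler_pM2l.
rewrite (mulrBr _ (c / r)) (mulrCA r c) divff ?gt_eqF // mulr1; lra.
Qed.

End xlogx.

(** * Densities: uniqueness, change of measure, chain rule *)

Section density_calculus.
Context d (T : measurableType d) (R : realType).
Implicit Types (nu eta rho : {measure set T -> \bar R}) (D E : set T).
Implicit Types (f g : T -> \bar R).

(* No integrability is needed, as [-oo] absorbs in extended real addition. *)
Lemma ae_le_integral nu D f g : measurable D ->
  measurable_fun D f -> measurable_fun D g ->
  {ae nu, forall x, D x -> f x <= g x} ->
  \int[nu]_(x in D) f x <= \int[nu]_(x in D) g x.
Proof.
move=> mD mf mg fg; rewrite integralE [leRHS]integralE.
apply: leeB; apply: ae_ge0_le_integral => //;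
  try exact: measurable_funepos; try exact: measurable_funeneg.
- apply: filterS fg => x fg Dx; rewrite !funeposE.
  by rewrite ge_max le_max fg //= le_max lexx orbT.
- apply: filterS fg => x fg Dx; rewrite !funenegE.
  by rewrite ge_max !le_max leeN2 fg //= lexx orbT.
Qed.

Lemma is_density_subset nu eta D E f :
  E `<=` D -> measurable D -> is_density nu eta D f -> is_density nu eta E f.
Proof.
move=> ED mD [mf f0 fE]; split.
- exact: measurable_funS mf.
- by move=> x /ED /f0.
- by move=> B mB BE; apply: fE => //; exact: subset_trans ED.
Qed.

Lemma density_spec nu eta D : has_density nu eta D ->
  is_density nu eta D (density nu eta D).
Proof. by move=> [f fP]; rewrite /density; case: xgetP => [g -> //|/(_ f)]. Qed.

(** Finiteness of [eta D] makes [f] integrable, and an integrable function is determined almost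
    everywhere by its integrals over measurable subsets. *)
Lemma is_density_ae_unique nu eta D f g : measurable D -> eta D < +oo ->
  is_density nu eta D f -> is_density nu eta D g -> ae_eq nu D f g.
Proof.
move=> mD etaD [mf f0 fE] [mg g0 gE]; apply: integral_ae_eq => //.
  apply/integrableP; split => //.
  rewrite (eq_integral f) -?fE // => x /[!inE] Dx.
  by rewrite gee0_abs // f0.
by move=> E ED mE; rewrite -fE // -gE.
Qed.

(** Truncating the density at 1 changes it on a null set only. The everywhere bound supplies the
    pointwise finiteness required by the change of measure below. *)
Lemma information_measure_bounded_density nu eta : information_measure nu eta ->
  exists2 f, is_density nu eta setT f & forall x, 0 <= f x <= 1.
Proof.
move=> [f [mf f0 fE] f01].
have mf1 : measurable_fun setT (fun x => mine (f x) 1) by exact: measurable_mine.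
exists (fun x => mine (f x) 1).
  split=> // [x _|B mB _]; first by rewrite le_min f0 //=.
  rewrite fE //; apply: ge0_ae_eq_integral => //.
  - exact: measurable_funS mf.
  - exact: measurable_funS mf1.
  - by move=> x _; exact: f0.
  - by move=> x _; rewrite le_min f0 /=.
  - by apply: filterS f01 => x /andP[_ f1] _; rewrite min_l.
by move=> x; rewrite le_min ge_min lexx orbT f0 /= ?lee01.
Qed.

(** Monotone convergence reduces the claim to simple functions, linearity to indicators of level
    sets, and there it is the defining property of [g]. *)
Lemma ge0_integral_density nu eta D f g : measurable D ->
  is_density nu eta D g -> (forall x, D x -> g x \is a fin_num) ->
  measurable_fun D f -> (forall x, 0 <= f x) ->
  \int[eta]_(x in D) f x = \int[nu]_(x in D) (f x * g x).
Proof.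
move=> mD [mg g0 gE] gfin mf f0.
pose h := nnsfun_approx mD mf.
have h0 n x : 0 <= (h n x)%:E by rewrite lee_fin.
have mh n A : measurable_fun A (EFin \o h n).
  by apply/measurable_EFinP; exact: measurable_funTS.
have -> : \int[eta]_(x in D) f x =
    limn (fun n => \int[eta]_(x in D) (h n x)%:E).
  have fE x : D x -> f x = limn (fun n => (h n x)%:E).
    by move=> Dx; apply/esym/cvg_lim => //; exact: cvg_nnsfun_approx.
  under eq_integral => x /[!inE] /fE -> //.
  apply: monotone_convergence => // [n|x Dx a b ab]; first exact: mh.
  by rewrite lee_fin; exact/lefP/nd_nnsfun_approx.
have -> : \int[nu]_(x in D) (f x * g x) =
    limn (fun n => \int[nu]_(x in D) ((h n x)%:E * g x)).
  have fgE x : D x -> f x * g x = limn (fun n => (h n x)%:E * g x).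
    (* Finiteness of [g x] lets the limit pass through the product. *)
    move=> Dx; apply/esym/cvg_lim => //; apply: cvgeZr; first exact: gfin.
    exact: cvg_nnsfun_approx.
  under eq_integral => x /[!inE] /fgE -> //.
  apply: monotone_convergence => // [n|n x Dx|x Dx a b ab].
  - by apply: emeasurable_funM => //; exact: mh.
  - by rewrite mule_ge0 // g0.
  - by rewrite lee_wpmul2r ?g0 // lee_fin; exact/lefP/nd_nnsfun_approx.
suff hE n : \int[eta]_(x in D) (h n x)%:E = \int[nu]_(x in D) ((h n x)%:E * g x).
  by under eq_fun do rewrite hE.
have mlevel r : measurable (h n @^-1` [set r]) by [].
have mlevelf r : measurable_fun D (fun x => (r * \1_(h n @^-1` [set r]) x)%:E).
  by apply/measurable_EFinP; apply: measurable_funTS; exact: measurable_funM.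
transitivity (\sum_(r \in range (h n))
    \int[eta]_(x in D) (r * \1_(h n @^-1` [set r]) x)%:E).
  rewrite -ge0_integral_fsum //; last first.
    by move=> r x Dx; exact: nnfun_muleindic_ge0.
  by apply: eq_integral => x _; rewrite [in LHS](fimfunE (h n)) -fsumEFin.
transitivity (\sum_(r \in range (h n))
    \int[nu]_(x in D) ((r * \1_(h n @^-1` [set r]) x)%:E * g x)); last first.
  rewrite -ge0_integral_fsum //; last 2 first.
  - by move=> r; apply: emeasurable_funM.
  - by move=> r x Dx; rewrite mule_ge0 ?g0 // nnfun_muleindic_ge0.
  apply: eq_integral => x _; rewrite -ge0_mule_fsuml => [|r].
    by rewrite fsumEFin // -(fimfunE (h n)).
  exact: nnfun_muleindic_ge0.
(* Writing the level as a value of [h n] shows that it is nonnegative, so it can be pulled out of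
   the integral. *)
apply: eq_fsbigr => r /[!inE] -[y _ <-]; set r0 := h n y.
rewrite integralZl_indic_nnsfun // integral_indic //.
under eq_integral do rewrite EFinM -muleA.
rewrite ge0_integralZl //; last 3 first.
- apply: emeasurable_funM => //; apply/measurable_EFinP.
  exact: measurable_funTS.
- by move=> x Dx; rewrite mule_ge0 ?g0 // lee_fin.
- by rewrite lee_fin.
congr (_ * _); rewrite gE; last 2 first.
- exact: measurableI.
- by move=> x [].
rewrite setIC integral_mkcondr; apply: eq_integral => x _.
by rewrite muleC epatch_indic.
Qed.

(** Multiplication by a finite nonnegative number commutes with positive and negative parts, so the
    nonnegative case applies to each; the integrals may be infinite. *)
Lemma integral_density nu eta D f g : measurable D ->
  is_density nu eta D g -> (forall x, D x -> g x \is a fin_num) ->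
  measurable_fun D f ->
  \int[eta]_(x in D) f x = \int[nu]_(x in D) (f x * g x).
Proof.
move=> mD dg gfin mf; have [_ g0 _] := dg.
rewrite integralE [RHS]integralE; congr (_ - _).
- rewrite (ge0_integral_density mD dg) //; last exact: measurable_funepos.
  apply: eq_integral => x /[!inE] Dx; rewrite !funeposE maxe_pMl ?mul0e ?g0 //.
  exact: gfin.
- rewrite (ge0_integral_density mD dg) //; last exact: measurable_funeneg.
  apply: eq_integral => x /[!inE] Dx; rewrite !funenegE maxe_pMl ?mul0e ?g0 //.
    by rewrite mulNe.
  exact: gfin.
Qed.

Lemma is_density_chain nu eta rho D f g : measurable D ->
  is_density nu eta D g -> (forall x, D x -> g x \is a fin_num) ->
  is_density eta rho D f -> is_density nu rho D (f \* g).
Proof.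
move=> mD dg gfin [mf f0 fE]; have [mg g0 _] := dg; split.
- exact: emeasurable_funM.
- by move=> x Dx; rewrite mule_ge0 ?f0 ?g0.
- move=> B mB BD; rewrite fE // (integral_density mB (is_density_subset BD mD dg)) //.
    by move=> x /BD; exact: gfin.
  exact: measurable_funS mf.
Qed.

End density_calculus.

(** * The two entropy inequalities *)

Section entropy_comparison.
Context d (T : measurableType d) (R : realType).
Implicit Types (nu eta rho mu xi : {measure set T -> \bar R}) (A : set T).

(** By almost everywhere uniqueness, the entropy may be computed with whichever density is
    convenient. *)
Lemma entropy_is_density nu eta A f : measurable A -> eta A < +oo ->
  is_density nu eta A f ->
  entropy nu eta A = lne (eta A) - (eta A)^-1 * \int[nu]_(x in A) xlogx (f x).
Proof.
move=> mA etaA df; have /density_spec dd : has_density nu eta A by exists f.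
rewrite /entropy; congr (_ - _ * _).
have [mdd _ _] := dd; have [mf _ _] := df.
apply: (@ae_eq_integral _ _ _ nu A (xlogx \o f) (xlogx \o density nu eta A)) => //.
- exact: measurable_xlogx.
- exact: measurable_xlogx.
- apply: filterS (is_density_ae_unique mA etaA dd df) => x + Ax.
  by move=> /(_ Ax) /= ->.
Qed.

Lemma entropy_self mu A : measurable A -> mu A < +oo ->
  entropy mu mu A = lne (mu A).
Proof.
move=> mA muA; rewrite (@entropy_is_density mu mu A (cst 1)) //.
  by rewrite integral0_eq ?mule0 ?sube0 // => x _; rewrite /xlogx lne1 mule0.
by split=> // B mB _; rewrite integral_cst // mul1e.
Qed.

Lemma information_measure_le mu rho A : measurable A ->
  information_measure mu rho -> rho A <= mu A.
Proof.
move=> mA /information_measure_bounded_density[f [mf f0 fE] f01].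
rewrite fE // -[leRHS]mul1e -integral_cst //; apply: ge0_le_integral => //.
- by move=> x _; exact: f0.
- exact: measurable_funS mf.
- by move=> x _; have /andP[] := f01 x.
Qed.

(** The integral enters the entropy with a negative sign, hence the reversed order. *)
Lemma entropy_le_of_xlogx_le nu nu' rho A f f' : measurable A ->
  0 < rho A < +oo -> is_density nu rho A f -> is_density nu' rho A f' ->
  \int[nu']_(x in A) xlogx (f' x) <= \int[nu]_(x in A) xlogx (f x) ->
  entropy nu rho A <= entropy nu' rho A.
Proof.
move=> mA /andP[rhoA0 rhoAoo] df df' ff'.
rewrite (entropy_is_density mA rhoAoo df) (entropy_is_density mA rhoAoo df').
by apply: leeB => //; apply: lee_wpmul2l => //; rewrite inve_ge0 ltW.
Qed.

Lemma entropy_change_reference mu xi rho A :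
  measurable A -> information_measure mu xi ->
  entropy_defined xi rho A -> entropy xi rho A <= entropy mu rho A.
Proof.
move=> mA info_xi [_ /density_spec dt rhoA].
have [g dg g01] := information_measure_bounded_density info_xi.
have dgA := is_density_subset (@subsetT _ A) measurableT dg.
have gfin x : A x -> g x \is a fin_num.
  by move=> _; have /andP[g0 g1] := g01 x; rewrite ge0_fin_numE // (le_lt_trans g1) ?ltry.
(* As density of [rho] with respect to [mu], take the product of its density with respect to [xi]
   and [g]. *)
have dtg := is_density_chain mA dgA gfin dt.
have [mt t0 _] := dt; have [mg _ _] := dgA; have [mtg _ _] := dtg.
apply: (entropy_le_of_xlogx_le mA rhoA dt dtg).
(* With the [xi]-integral moved to [mu], the integrands compare pointwise. *)
rewrite (integral_density mA dgA gfin); last exact: measurable_xlogx.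
apply: ae_le_integral => //.
- exact: measurable_xlogx.
- by apply: emeasurable_funM => //; exact: measurable_xlogx.
- by apply: aeW => x Ax; apply: xlogx_mul_le; [exact: t0|exact: g01].
Qed.

Lemma entropy_le_lne mu rho A : measurable A -> information_measure mu rho ->
  0 < rho A -> mu A < +oo -> entropy mu rho A <= lne (mu A).
Proof.
move=> mA info_rho rhoA0 muAoo.
have rho_le_mu := information_measure_le mA info_rho.
have rhoAoo := le_lt_trans rho_le_mu muAoo.
have muA0 := lt_le_trans rhoA0 rho_le_mu.
have [f df f01] := information_measure_bounded_density info_rho.
have dfA := is_density_subset (@subsetT _ A) measurableT df.
rewrite (entropy_is_density mA rhoAoo dfA).
have [mf f0 fE] := dfA.
have ffin x : f x = (fine (f x))%:E.
  have /andP[g0 g1] := f01 x.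
  by rewrite fineK // ge0_fin_numE // (le_lt_trans g1) ?ltry.
pose r := fine (rho A); pose m := fine (mu A); pose c := (r / m)%R.
have rE : rho A = r%:E by rewrite fineK // ge0_fin_numE.
have mE : mu A = m%:E by rewrite fineK // ge0_fin_numE.
have r0 : (0 < r)%R by rewrite -lte_fin -rE.
have m0 : (0 < m)%R by rewrite -lte_fin -mE.
have c0 : (0 < c)%R by rewrite divr_gt0.
(* Finiteness of [rho A] and [mu A] makes both terms of the tangent line integrable, so its integral
   can be split. *)
have intf : mu.-integrable A (fun x => (fine (f x))%:E).
  apply/integrableP; split.
    by apply: eq_measurable_fun mf => x _; rewrite -ffin.
  under eq_integral do rewrite -ffin.
  under eq_integral => x /[!inE] Ax do rewrite gee0_abs ?f0 //.
  by rewrite -fE.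
have intcst : mu.-integrable A (EFin \o cst c).
  apply/integrableP; split; first exact/measurable_EFinP/measurable_cst.
  by have /= -> := integral_cst mu mA `|c|%:E; rewrite lte_mul_pinfty ?lee_fin.
have Ige : (r * ln c)%:E <= \int[mu]_(x in A) xlogx (f x).
  (* The tangent line integrates to [r * (ln c + 1) - c * m], and [c * m = r]. *)
  have -> : (r * ln c)%:E =
      \int[mu]_(x in A) (fine (f x) * (ln c + 1) - c)%:E.
    under eq_integral do rewrite EFinB.
    have intfl : mu.-integrable A (EFin \o (fun x => fine (f x) * (ln c + 1))%R).
      by apply: eq_integrable (integrableZr mA (ln c + 1)%R intf).
    rewrite (integralB_EFin mA intfl intcst).
    under eq_integral do rewrite EFinM.
    rewrite integralZr //; have /= -> := integral_cst mu mA c%:E.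
    under eq_integral do rewrite -ffin.
    rewrite -fE // rE mE -!EFinM -EFinB; congr EFin.
    by rewrite /c; field; rewrite gt_eqF.
  apply: ae_le_integral => //.
  - apply/measurable_EFinP; apply: measurable_funB => //.
    apply: measurable_funM => //; apply/measurable_EFinP.
    exact: (measurable_int mu).
  - exact: (measurable_xlogx mf).
  - apply: aeW => x Ax; rewrite [in leRHS]ffin; apply: xlogx_ge_tangent => //.
    by rewrite -lee_fin -ffin; exact: f0.
(* Since [ln c = ln r - ln m], the Jensen bound [Ige] gives exactly [lne (mu A)]. *)
have -> : lne (mu A) = lne (rho A) - (rho A)^-1 * (r * ln c)%:E.
  rewrite rE mE !lne_EFin // inver gt_eqF // -EFinM -EFinB; congr EFin.
  by rewrite mulrA mulVf ?gt_eqF // mul1r ln_div ?posrE //; ring.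
by apply: leeB => //; apply: lee_wpmul2l => //; rewrite inve_ge0 ltW.
Qed.

End entropy_comparison.

(** * Left translates of Borel sets *)

Section translation.
Variable G : topologicalGroupType.

Lemma continuous_lmulg (g : G) : continuous (fun x : G => (g * x)%g).
Proof.
move=> x.
apply: (@continuous_comp G _ G (fun y => (g, y)) (fun z : G * G => z.1 * z.2)%g).
  by apply: cvg_pair => //; exact: cvg_cst.
exact: mulg_continuous.
Qed.

(** As a preimage under a continuous map, a translate inherits Borel measurability. *)
Lemma ltranslateE (g : G) (A : set G) :
  ltranslate g A = (fun x => (g^-1 * x)%g) @^-1` A.
Proof.
apply/seteqP; split=> [_ [x Ax <-]|x Ax] /=; first by rewrite mulKg.
by exists (g^-1 * x)%g => //; rewrite mulVKg.
Qed.

Lemma measurable_ltranslate (g : G) (A : set (borel G)) :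
  measurable A -> measurable (ltranslate g A : set (borel G)).
Proof.
move=> mA; rewrite ltranslateE.
have mf : measurable_fun (setT : set (borel G))
    ((fun x => (g^-1 * x)%g) : borel G -> borel G).
  apply: (@measurability _ _ (borel G) (borel G) _ _ (@open G)) => //.
  move=> _ [U oU <-]; rewrite setTI; apply: sub_sigma_algebra.
  by apply: open_comp oU => x _; exact: continuous_lmulg.
by rewrite -[X in measurable X]setTI; exact: mf.
Qed.

End translation.

Theorem theorem4p1 (R : realType) (G : topologicalGroupType)
  (mu rho xi : {measure set (borel G) -> \bar R})
  (lcG : locally_compact [set: G])
  (haar_mu : haar_measure mu)
  (info_rho : information_measure mu rho)
  (info_xi : information_measure mu xi)
  (A : set G) (cA : compact A)
  (def_xi_rho : entropy_defined xi rho A)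
  (def_mu_rho : entropy_defined mu rho A) :
  entropy xi rho A <= entropy mu rho A <= entropy mu mu A /\
  (forall g : G, entropy mu mu A = entropy mu mu (ltranslate g A) /\
                 entropy mu mu (ltranslate g A) = lne (mu A)).
Proof.
have [mA _ /andP[rhoA0 _]] := def_mu_rho.
(* Compactness of [A] enters here; measurability of [A] comes from [def_mu_rho]. *)
have muA : mu A < +oo := haar_compact_finite haar_mu cA mA.
split.
  rewrite entropy_change_reference //= entropy_self //.
  exact: entropy_le_lne.
move=> g; have muE : mu (ltranslate g A) = mu A.
  exact: (haar_left_invariant haar_mu).
rewrite [in LHS]entropy_self // entropy_self ?muE //.
exact: measurable_ltranslate.
Qed.
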